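(* Let $\mathcal{N}$ be a connected plane Euclidean network whose locus satisfies $\mathrm{diam}(CH(\mathcal{N}_{\ell}))<\mathrm{diam}(\mathcal{N}_{\ell})$. Then for every $\varepsilon>0$ with $\mathrm{diam}(CH(\mathcal{N}_{\ell}))+\varepsilon<\mathrm{diam}(\mathcal{N}_{\ell})$ there exists a shortcut set $\mathcal{S}$ for $\mathcal{N}_{\ell}$ such that $$\mathrm{diam}(CH(\mathcal{N}_{\ell}))\le \mathrm{diam}(\mathcal{N}_{\ell}\cup\mathcal{S})<\mathrm{diam}(CH(\mathcal{N}_{\ell}))+\varepsilon.$$
   Context: A plane Euclidean network $\mathcal{N}$ is a finite graph whose vertices are points of $\mathbb{R}^2$ and whose edges are straight-line segments between their endpoints, with no two edges crossing; edge lengths are Euclidean lengths. Its locus $\mathcal{N}_{\ell}$ is the closed set of all points lying on $\mathcal{N}$. For a closed union $X$ of finitely many segments (all intersection points being network points), $d_X(p,q)$ is the length of a shortest path from $p$ to $q$ within $X$, and $\mathrm{diam}(X)=\max_{p,q\in X}d_X(p,q)$. $CH(\mathcal{N}_{\ell})$ is the convex hull of $\mathcal{N}_{\ell}$ and $\mathrm{diam}(CH(\mathcal{N}_{\ell}))$ its Euclidean diameter. A shortcut set for $\mathcal{N}_{\ell}$ is a finite set $\mathcal{S}=\{s_1,\dots,s_k\}$ of straight segments such that $s_1$ has both endpoints on $\mathcal{N}_{\ell}$, each $s_i$ ($i\ge 2$) has both endpoints on $\mathcal{N}_{\ell}\cup s_1\cup\dots\cup s_{i-1}$, and $\mathrm{diam}(\mathcal{N}_{\ell}\cup\mathcal{S})<\mathrm{diam}(\mathcal{N}_{\ell})$.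 *)

(* Defs.v *)
From HB Require Import structures.
From mathcomp Require Import all_boot all_order all_algebra finmap.
From mathcomp Require Import all_classical all_reals all_analysis.

Set Implicit Arguments.
Unset Strict Implicit.
Unset Printing Implicit Defensive.

Import Order.TTheory GRing.Theory Num.Theory.

Local Open Scope classical_set_scope.
Local Open Scope ring_scope.

Section PlaneNetworks.
Variable R : realType.
Local Notation pt := 'rV[R]_2.

(* The canonical norm of 'rV[R]_2 is the max norm, hence the explicit
   Euclidean distance. *)
Definition euclid_dist (p q : pt) : R :=
  Num.sqrt (\sum_(i < 2) (p ord0 i - q ord0 i) ^+ 2).

Definition segment (p q : pt) : set pt :=
  [set x | exists2 t : R, 0 <= t <= 1 & x = (1 - t) *: p + t *: q].

Definition convex_hull (A : set pt) : set pt := smallest (@convex_set R pt) A.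

Definition euclid_diam (A : set pt) : \bar R :=
  ereal_sup [set (euclid_dist p q)%:E | p in A & q in A].

(* A path is a polygonal chain, given by its starting point p and the list s of
   its successive vertices; it lies in X when each of its sides does. In a
   finite union of segments a chain may turn at any intersection point. *)
Fixpoint path_within (X : set pt) (p : pt) (s : seq pt) : Prop :=
  if s is x :: s' then segment p x `<=` X /\ path_within X x s' else X p.

Definition path_length (p : pt) (s : seq pt) : R :=
  \sum_(l <- pairmap euclid_dist p s) l.

(* Equal to +oo when no path joins p to q in X. *)
Definition geo_dist (X : set pt) (p q : pt) : \bar R :=
  ereal_inf [set (path_length p s)%:E |
             s in [set s | path_within X p s /\ last p s = q]].

Definition geo_diam (X : set pt) : \bar R :=
  ereal_sup [set geo_dist X p q | p in X & q in X].

Record plane_network := PlaneNetwork {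
  vertices : {fset pt};
  adj : rel vertices;
  adj_sym : symmetric adj;
  adj_irrefl : irreflexive adj;
  no_crossing : forall u v u' v' : vertices, adj u v -> adj u' v' ->
    [fset val u; val v]%fset != [fset val u'; val v']%fset ->
    segment (val u) (val v) `&` segment (val u') (val v')
      `<=` [set val u; val v] `&` [set val u'; val v']
}.

Definition network_connected (N : plane_network) : Prop :=
  forall u v : vertices N, connect (@adj N) u v.

Definition locus (N : plane_network) : set pt :=
  [set x | x \in vertices N \/
     exists u v : vertices N, adj u v /\ segment (val u) (val v) x].

(* Segments are given by their pairs of endpoints. *)
Definition add_segments (X : set pt) (S : seq (pt * pt)) : set pt :=
  X `|` \bigcup_(s in [set` S]) segment s.1 s.2.

Fixpoint attached (X : set pt) (S : seq (pt * pt)) : Prop :=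
  if S is s :: S' then
    [/\ s.1 != s.2, X s.1, X s.2 & attached (X `|` segment s.1 s.2) S']
  else True.

Definition shortcut_set (X : set pt) (S : seq (pt * pt)) : Prop :=
  attached X S /\ (geo_diam (add_segments X S) < geo_diam X)%E.

End PlaneNetworks.

(* Main.v *)
Require Import Defs.
From mathcomp Require Import all_boot all_order all_algebra finmap.
From mathcomp Require Import all_classical all_reals all_analysis.
From mathcomp Require Import ring lra.

(* Let [V] be the set of vertices and iterate [n] times the operation adding to a
   finite point set all midpoints of its pairs; every new point lies on a segment
   joining two old ones, so the segments joining all pairs of the resulting set
   [P] can be attached successively, and together they contain the locus.
   By Caratheodory's theorem and medial subdivision, every point of the hull lies
   in a triangle with corners in [P] and sides at most [D / 2 ^ n], where [D] is
   the diameter of the hull.  A point on a segment joining two points of [P]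
   follows it until it meets a side of its small triangle (or the end of the
   segment, if that lies in the triangle), hence reaches a point of [P] within
   [2 D / 2 ^ n]; any two points of [P] are joined by a straight segment.  So the
   new diameter is at most [D + 4 D / 2 ^ n].  It is at least [D] because paths
   are no shorter than Euclidean distances and balls are convex. *)

Set Implicit Arguments.
Unset Strict Implicit.
Unset Printing Implicit Defensive.

Import Order.TTheory GRing.Theory Num.Theory.

Local Open Scope classical_set_scope.
Local Open Scope ring_scope.

Section EuclideanPlane.
Variable R : realType.
Local Notation pt := 'rV[R]_2.
Implicit Types (p q x y a b c u v : pt) (X : set pt) (P : seq pt).

(** * Euclidean norm and distance *)

Definition enorm v : R :=
  Num.sqrt (v ord0 ord0 ^+ 2 + v ord0 ord_max ^+ 2).

Lemma euclid_distE p q : euclid_dist p q = enorm (p - q).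
Proof.
rewrite /euclid_dist /enorm big_ord_recl big_ord1 !mxE.
by rewrite (_ : lift ord0 ord0 = ord_max)//; apply/val_inj.
Qed.

Lemma enorm_ge0 v : 0 <= enorm v. Proof. exact: sqrtr_ge0. Qed.

Lemma enormZ (k : R) v : 0 <= k -> enorm (k *: v) = k * enorm v.
Proof.
move=> k0; rewrite /enorm !mxE !exprMn -mulrDr sqrtrM ?sqr_ge0//.
by rewrite sqrtr_sqr ger0_norm.
Qed.

Lemma enormN v : enorm (- v) = enorm v.
Proof. by rewrite /enorm !mxE !sqrrN. Qed.

Lemma enormD u v : enorm (u + v) <= enorm u + enorm v.
Proof.
rewrite -ler_sqr ?nnegrE ?enorm_ge0 ?addr_ge0 ?enorm_ge0//.
have sE w : enorm w ^+ 2 = w ord0 ord0 ^+ 2 + w ord0 ord_max ^+ 2.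
  by rewrite sqr_sqrtr// addr_ge0 ?sqr_ge0.
suff cs : u ord0 ord0 * v ord0 ord0 + u ord0 ord_max * v ord0 ord_max
    <= enorm u * enorm v.
  by rewrite sqrrD !sE !mxE; lra.
rewrite (le_trans (ler_norm _))// -ler_sqr ?nnegrE ?mulr_ge0 ?enorm_ge0//.
rewrite real_normK ?num_real// exprMn !sE.
(* By Lagrange's identity, the gap in the squared Cauchy-Schwarz inequality is the squared
   determinant of [u] and [v]. *)
have := sqr_ge0 (u ord0 ord0 * v ord0 ord_max - u ord0 ord_max * v ord0 ord0).
nra.
Qed.

Lemma euclid_dist_sym p q : euclid_dist p q = euclid_dist q p.
Proof. by rewrite !euclid_distE -enormN opprB. Qed.

Lemma euclid_dist_triangle y x z :
  euclid_dist x z <= euclid_dist x y + euclid_dist y z.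
Proof. by rewrite !euclid_distE (le_trans _ (enormD _ _))// subrKA. Qed.

Lemma euclid_dist_xx p : euclid_dist p p = 0.
Proof. by rewrite euclid_distE subrr /enorm !mxE expr0n addr0 sqrtr0. Qed.

(** * Segments and triangles, possibly degenerate *)

Definition triangle a b c : set pt := [set x | exists k l m : R,
  [/\ 0 <= k, 0 <= l, 0 <= m, k + l + m = 1 & x = k *: a + l *: b + m *: c]].

Lemma triangle_cornerl a b c : triangle a b c a.
Proof. by exists 1, 0, 0; split; rewrite ?addr0// scale1r !scale0r !addr0. Qed.

Lemma segment_triangle a b : segment a b = triangle a b b.
Proof.
apply/seteqP; split=> x.
  by move=> [t /andP[t0 t1] ->]; exists (1 - t), t, 0; split;
    rewrite ?scale0r ?addr0//; lra.
move=> [k [l [m [k0 l0 m0 klm ->]]]]; exists (l + m); first lra.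
have -> : k = 1 - l - m by lra.
  by apply/rowP => i; rewrite !mxE; ring.
Qed.

(** The distance to [y] is a convex function: as the weights sum to 1, [x - y] is the same
    combination of the three differences. *)
Lemma euclid_dist_triangle_le a b c x y (d : R) : triangle a b c x ->
  euclid_dist a y <= d -> euclid_dist b y <= d -> euclid_dist c y <= d ->
  euclid_dist x y <= d.
Proof.
move=> [k [l [m [k0 l0 m0 klm ->]]]]; rewrite !euclid_distE => da db dc.
have -> : k *: a + l *: b + m *: c - y =
    k *: (a - y) + l *: (b - y) + m *: (c - y).
  have -> : k = 1 - l - m by lra.
  by apply/rowP => i; rewrite !mxE; ring.
rewrite (le_trans (enormD _ _))// (le_trans (lerD (enormD _ _) (lexx _)))//.
rewrite !enormZ//; have -> : k = 1 - l - m by lra.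
nra.
Qed.

Lemma segment_sym a b : segment a b = segment b a.
Proof.
suff H u v : segment u v `<=` segment v u by apply/seteqP; split; apply: H.
by move=> x [t t01 ->]; exists (1 - t); rewrite 1?addrC ?subKr//; lra.
Qed.

Lemma segment_left a b : segment a b a.
Proof. by exists 0; rewrite ?lexx ?ler01// subr0 scale1r scale0r addr0. Qed.

Lemma segment_xx a : segment a a = [set a].
Proof.
apply/seteqP; split=> [x [t _ ->]|x ->]; last exact: segment_left.
by rewrite -scalerDl subrK scale1r.
Qed.

Lemma segment_convex a b x y : segment a b x -> segment a b y ->
  segment x y `<=` segment a b.
Proof.
move=> [s /andP[s0 s1] ->] [t /andP[t0 t1] ->] z [r /andP[r0 r1] ->].
exists ((1 - r) * s + r * t); last by apply/rowP => i; rewrite !mxE; ring.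
by apply/andP; split; nra.
Qed.

Lemma euclid_dist_segment_le a b x y (d : R) : segment a b x ->
  euclid_dist a y <= d -> euclid_dist b y <= d -> euclid_dist x y <= d.
Proof.
by rewrite segment_triangle => abx ay yb; exact: euclid_dist_triangle_le abx _ _ _.
Qed.

(** Convexity of the distance is used twice, first moving [y] to the corners, then [x]. *)
Lemma triangle_diameter a b c x y (d : R) :
  euclid_dist a b <= d -> euclid_dist b c <= d -> euclid_dist a c <= d ->
  triangle a b c x -> triangle a b c y -> euclid_dist x y <= d.
Proof.
move=> ab bc ac tx ty; have d0 : 0 <= d.
  by apply: le_trans ab; rewrite euclid_distE enorm_ge0.
have corner z : z = a \/ z = b \/ z = c -> euclid_dist z y <= d.
  move=> H; rewrite euclid_dist_sym; apply: (euclid_dist_triangle_le ty).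
  - by case: H => [|[]] ->; rewrite ?euclid_dist_xx.
  - by case: H => [|[]] ->; rewrite ?euclid_dist_xx// euclid_dist_sym.
  - by case: H => [|[]] ->; rewrite ?euclid_dist_xx// euclid_dist_sym.
by apply: (euclid_dist_triangle_le tx); apply: corner; tauto.
Qed.

(* Moving nonnegative weights [w] in a direction [g] with a negative entry,
   stop as soon as one of the weights vanishes. *)
Lemma first_vanishing (I : finType) (w g : I -> R) (j : I) :
  (forall i, 0 <= w i) -> g j < 0 ->
  exists (s : R) (i : I), [/\ 0 <= s, w i + s * g i = 0 &
    forall i', 0 <= w i' + s * g i'].
Proof.
move=> w0 gj.
have [i gi imin] := @arg_minP _ _ _ j (fun i => g i < 0) (fun i => w i / - g i) gj.
have s0 : 0 <= w i / - g i by rewrite divr_ge0// oppr_ge0 ltW.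
exists (w i / - g i), i; split=> //.
  by rewrite invrN mulrN mulNr divfK ?subrr// lt_eqF.
move=> i'; case: (ltP (g i') 0) => gi'; last by rewrite addr_ge0// mulr_ge0.
have := imin _ gi'; rewrite -(ler_pM2r (x := - g i')) ?oppr_gt0//.
rewrite divfK ?oppr_eq0 ?lt_eqF//; lra.
Qed.

(** * Affine dependence of four points of the plane *)

Lemma affine_dependence (f : 'I_4 -> pt) : exists g : 'I_4 -> R,
  [/\ exists i, g i != 0, \sum_i g i = 0 & \sum_i g i *: f i = 0].
Proof.
pose F : 'M[R]_(4, 2) := \matrix_i f i.
pose A := row_mx F (const_mx 1 : 'cV_4).
(* [A] has four rows and three columns, so some nonzero row [v] satisfies [v *m A = 0]; the column
   of ones makes its entries sum to 0. *)
have /rowV0Pn[v /sub_kermxP vA v0] : kermx A != 0.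
  by rewrite -mxrank_eq0 mxrank_ker subn_eq0 -ltnNge ltnS rank_leq_col.
move: vA; rewrite mul_mx_row => /eqP; rewrite row_mx_eq0 => /andP[/eqP vF /eqP v1].
exists (v 0); split.
- by apply/existsP; apply: contraNT v0 => /existsPn v0; apply/eqP/rowP => i;
    have := v0 i; rewrite negbK mxE => /eqP.
- have := congr1 (fun M : 'M[R]_1 => M 0 0) v1; rewrite !mxE => v1E; rewrite -[RHS]v1E.
  by apply: eq_bigr => i _; rewrite mxE mulr1.
- by rewrite -[RHS]vF mulmx_sum_row; apply: eq_bigr => i _; rewrite rowK.
Qed.

Lemma affine_dependence4 a b c e : exists k l m n : R,
  [/\ (k != 0) || (l != 0) || (m != 0) || (n != 0), k + l + m + n = 0 &
   k *: a + l *: b + m *: c + n *: e = 0].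
Proof.
have [g []] := affine_dependence (fun i => nth 0 [:: a; b; c; e] i).
move=> -[i gi] g1 gE; have : \sum_i g i ^+ 2 != 0.
  rewrite psumr_neq0; last by move=> j _; exact: sqr_ge0.
  by apply/hasP; exists i; rewrite ?mem_index_enum// lt0r sqr_ge0 sqrf_eq0 gi.
move: g1 gE; rewrite !big_ord_recr !big_ord0 /= !add0r => g1 gE gn0.
do 4 eexists; split; [|exact: g1|exact: gE].
by apply: contraNT gn0; rewrite !negb_or !negbK => /andP[/andP[/andP[]]];
  do 4 move=> /eqP ->; rewrite expr0n !addr0.
Qed.

(** In barycentric coordinates the motion from [p] to [q] is affine; if [q] is outside, some
    coordinate decreases to 0 on the way, and there the point lies on a side. *)
Lemma triangle_exit a b c p q : triangle a b c p -> triangle a b c q \/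
  exists x, [/\ segment p q x, triangle a b c x &
    segment a b x \/ segment b c x \/ segment a c x].
Proof.
move=> tp.
have side x (k l m : R) : 0 <= k -> 0 <= l -> 0 <= m -> k + l + m = 1 ->
    x = k *: a + l *: b + m *: c -> (k == 0) || (l == 0) || (m == 0) ->
    triangle a b c x /\ (segment a b x \/ segment b c x \/ segment a c x).
  move=> k0 l0 m0 klm xE z; split; first by exists k, l, m.
  case/orP: z => [/orP[]|] /eqP z; subst.
  - right; left; exists m; first lra.
    by have -> : 1 - m = l; [lra|rewrite scale0r add0r].
  - right; right; exists m; first lra.
    by have -> : 1 - m = k; [lra|rewrite scale0r addr0].
  - left; exists l; first lra.
    by have -> : 1 - l = k; [lra|rewrite scale0r addr0].
move: (tp) => [k [l [m [k0 l0 m0 klm pE]]]].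
pose w (i : 'I_3) := nth 0 [:: k; l; m] i.
have w0 i : 0 <= w i by case: i => -[|[|[|//]]].
(* The direction [z] changes the weights of [p] at the rates [gk], [gl], [gm]. If some weight is
   negative at time 1, then the stopping time [s] is at most 1, because the weights are nonnegative
   at times 0 and [s]. *)
have exit (gk gl gm : R) (z : pt) : (gk < 0) || (gl < 0) || (gm < 0) ->
    gk + gl + gm = 0 -> z = gk *: a + gl *: b + gm *: c ->
    exists (s : R), [/\ 0 <= s, triangle a b c (p + s *: z),
      (segment a b (p + s *: z) \/ segment b c (p + s *: z) \/
       segment a c (p + s *: z)) &
      (0 <= k + gk -> 0 <= l + gl -> 0 <= m + gm -> False) -> s <= 1].
  move=> gneg g0 zE; pose g (i : 'I_3) := nth 0 [:: gk; gl; gm] i.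
  have [j gj] : exists j, g j < 0.
    case/orP: gneg => [/orP[]|] gn.
    - by exists ord0.
    - by exists (@Ordinal 3 1 isT).
    - by exists ord_max.
  have [s [i [s0 wi wge]]] := first_vanishing w0 gj.
  have := wge ord0; have := wge (@Ordinal 3 1 isT); have := wge ord_max.
  rewrite /w /g /= => mm ll kk.
  have [||||||sT sS] := @side (p + s *: z) (k + s * gk) (l + s * gl) (m + s * gm) => //.
  - by rewrite -klm -[RHS]addr0 -[X in _ = _ + X](mulr0 s) -g0; ring.
  - by rewrite pE zE; apply/rowP => t; rewrite !mxE; ring.
  - by move: wi; rewrite /w /g; case: (i) => -[|[|[|//]]] /= _ ->;
      rewrite eqxx ?orbT.
  exists s; split=> // H; rewrite leNgt; apply/negP => s1; apply: H; nra.
have [gk [gl [gm [gn [gneq g0 gE]]]]] := affine_dependence4 a b c q.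
have [gn0|gn0] := eqVneq gn 0.
  (* The corners themselves are affinely dependent: moving the weights along the dependence leaves
     the point [p] fixed, so [p] is already on a side. *)
  right; move: gneq g0 gE; rewrite gn0 eqxx orbF scale0r !addr0 => gneq g0 gE.
  have [|||s [s0 sT sS _]] := @exit gk gl gm 0 => //.
    apply: contraTT gneq; rewrite !negb_or !negbK -!leNgt -!andbA.
    move=> /and3P[gk0 gl0 gm0].
    by apply/and3P; split; apply/eqP; lra.
  exists p; move: sT sS; rewrite scaler0 addr0; split=> //; exact: segment_left.
(* Otherwise the dependence can be solved for [q], which gives its barycentric coordinates. *)
pose qk := - gk / gn; pose ql := - gl / gn; pose qm := - gm / gn.
have q1 : qk + ql + qm = 1.
  by rewrite /qk /ql /qm -!mulrDl -!opprD (_ : gk + gl + gm = - gn) ?opprK ?divff//; lra.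
have qE : q = qk *: a + ql *: b + qm *: c.
  rewrite /qk /ql /qm; apply/rowP => i; rewrite !mxE.
  have := congr1 (fun v : pt => v 0 i) gE; rewrite !mxE => gEi.
  have -> : q 0 i = - (gk * a 0 i + gl * b 0 i + gm * c 0 i) / gn.
    by apply: (canRL (mulfK gn0)); lra.
  by field.
have [q0|] := boolP [&& 0 <= qk, 0 <= ql & 0 <= qm].
  by left; exists qk, ql, qm; case/and3P: q0.
rewrite !negb_and -!ltNge => qneg; right.
have [|||s [s0 sT sS s1]] := @exit (qk - k) (ql - l) (qm - m) (q - p).
- by rewrite -orbA; apply/or3P; case/or3P: qneg => qn;
    [apply: Or31|apply: Or32|apply: Or33]; lra.
- lra.
- by rewrite qE pE; apply/rowP => i; rewrite !mxE; ring.
exists (p + s *: (q - p)); split=> //; exists s.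
  rewrite s0 s1// => qk0 ql0 qm0.
  by case/or3P: qneg => qn; lra.
by apply/rowP => i; rewrite !mxE; ring.
Qed.

(** * The convex hull of a finite point set as a union of triangles *)

Definition polygon P : set pt := [set x | exists a b c,
  [/\ a \in P, b \in P, c \in P & triangle a b c x]].

(** Leaving the total weight [r] free makes these sets stable under scaling and addition, so that
    convexity of the slice [r = 1] reduces to adding one weighted point at a time. *)
Definition cone P (r : R) : set pt := [set z | exists a b c (k l m : R),
  [/\ [/\ a \in P, b \in P & c \in P], [/\ 0 <= k, 0 <= l & 0 <= m],
   r = k + l + m & z = k *: a + l *: b + m *: c]].

Lemma polygon_cone P : polygon P = cone P 1.
Proof.
apply/seteqP; split=> x.
  by move=> [a [b [c [aP bP cP [k [l [m [? ? ? ? ?]]]]]]]]; exists a, b, c, k, l, m.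
move=> [a [b [c [k [l [m [[aP bP cP] [? ? ?] ? ?]]]]]]].
by exists a, b, c; split=> //; exists k, l, m.
Qed.

Lemma coneZ P (r s : R) z : 0 <= s -> cone P r z -> cone P (s * r) (s *: z).
Proof.
move=> s0 [a [b [c [k [l [m [abc [? ? ?] -> ->]]]]]]].
exists a, b, c, (s * k), (s * l), (s * m); split=> //.
- by rewrite !mulr_ge0.
- ring.
- by apply/rowP => i; rewrite !mxE; ring.
Qed.

(* Caratheodory's theorem in homogeneous form: an affine dependence among the
   four points involved allows one of them to be dropped. *)
Lemma cone_add_point P (r t : R) z v :
  v \in P -> 0 <= t -> cone P r z -> cone P (r + t) (z + t *: v).
Proof.
move=> vP t0 [a [b [c [k [l [m [[aP bP cP] [k0 l0 m0] -> ->]]]]]]].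
have [gk [gl [gm [gn [gneq g0 gE]]]]] := affine_dependence4 a b c v.
pose w (i : 'I_4) := nth 0 [:: k; l; m; t] i.
pose g (i : 'I_4) := nth 0 [:: gk; gl; gm; gn] i.
have w0 i : 0 <= w i by case: i => -[|[|[|[|//]]]].
have [j gj] : exists j, g j < 0.
  have [?|gk0] := ltP gk 0; first by exists ord0.
  have [?|gl0] := ltP gl 0; first by exists (@Ordinal 4 1 isT).
  have [?|gm0] := ltP gm 0; first by exists (@Ordinal 4 2 isT).
  have [?|gn0] := ltP gn 0; first by exists ord_max.
  exfalso; move: gneq; apply/negP; rewrite !negb_or !negbK -!andbA.
  by apply/and4P; split; apply/eqP; lra.
have [s [i [s0 wi wge]]] := first_vanishing w0 gj.
have := wge ord0; have := wge (@Ordinal 4 1 isT); have := wge (@Ordinal 4 2 isT).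
have := wge ord_max; rewrite /w /g /= => nn mm ll kk.
have sg0 : s * gk + s * gl + s * gm + s * gn = 0.
  by rewrite -!mulrDr g0 mulr0.
have sgE (h : 'I_2) : s * gk * a 0 h + s * gl * b 0 h + s * gm * c 0 h
    + s * gn * v 0 h = 0.
  have := congr1 (fun u : pt => u 0 h) gE; rewrite !mxE => gEh.
  by rewrite -!mulrA -!mulrDr gEh mulr0.
(* Whichever weight has vanished, the other three points carry the combination; in the last case the
   dropped point is [v]. *)
move: wi; rewrite /w /g; case: i => -[|[|[|[|//]]]] /= _ z0.
- exists b, c, v, (l + s * gl), (m + s * gm), (t + s * gn); split=> //.
    lra.
  apply/rowP => h; rewrite !mxE.
  have := congr1 (fun r : R => r * a 0 h) z0; have := sgE h; lra.
- exists a, c, v, (k + s * gk), (m + s * gm), (t + s * gn); split=> //.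
    lra.
  apply/rowP => h; rewrite !mxE.
  have := congr1 (fun r : R => r * b 0 h) z0; have := sgE h; lra.
- exists a, b, v, (k + s * gk), (l + s * gl), (t + s * gn); split=> //.
    lra.
  apply/rowP => h; rewrite !mxE.
  have := congr1 (fun r : R => r * c 0 h) z0; have := sgE h; lra.
- exists a, b, c, (k + s * gk), (l + s * gl), (m + s * gm); split=> //.
    lra.
  apply/rowP => h; rewrite !mxE.
  have := congr1 (fun r : R => r * v 0 h) z0; have := sgE h; lra.
Qed.

Lemma coneD P (r s : R) y z : cone P r y -> cone P s z -> cone P (r + s) (y + z).
Proof.
move=> Py [a [b [c [k [l [m [[aP bP cP] [? ? ?] -> ->]]]]]]].
by rewrite !addrA; do 3 apply: cone_add_point => //.
Qed.

Lemma polygon_convex P x y : polygon P x -> polygon P y ->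
  segment x y `<=` polygon P.
Proof.
rewrite polygon_cone => Px Py z [t /andP[t0 t1] ->].
have t1' : 0 <= 1 - t by rewrite subr_ge0.
by have := coneD (coneZ t1' Px) (coneZ t0 Py); rewrite !mulr1 subrK.
Qed.

Lemma sub_polygon P a : a \in P -> polygon P a.
Proof. by move=> aP; exists a, a, a; split=> //; exact: triangle_cornerl. Qed.

(** * Repeated subdivision by midpoints *)

Definition midpoint a b : pt := 2^-1 *: (a + b).

Lemma segment_midpoint a b : segment a b (midpoint a b).
Proof.
exists 2^-1; first lra.
by apply/rowP => i; rewrite !mxE; lra.
Qed.

Lemma midpoint_xx a : midpoint a a = a.
Proof. by apply/rowP => i; rewrite !mxE; lra. Qed.

Lemma midpointC a b : midpoint a b = midpoint b a.
Proof. by rewrite /midpoint addrC. Qed.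

Lemma euclid_dist_midpoint a b c :
  euclid_dist (midpoint a b) (midpoint a c) = euclid_dist b c / 2.
Proof.
rewrite !euclid_distE mulrC -enormZ; last lra.
by congr enorm; apply/rowP => i; rewrite !mxE; ring.
Qed.

Definition midpoints P := [seq midpoint a b | a <- P, b <- P].

Lemma mem_midpoints P a b : a \in P -> b \in P -> midpoint a b \in midpoints P.
Proof. by move=> aP bP; apply/allpairsP; exists (a, b). Qed.

Lemma midpoints_sub P : {subset P <= midpoints P}.
Proof. by move=> a aP; rewrite -(midpoint_xx a) mem_midpoints. Qed.

(** Serves with [A] the convex hull of the locus, to bound distances between subdivision points, and
    with [A] a polygon, to place them in triangles with corners in the initial set. *)
Lemma iter_midpoints_convex (A : set pt) P n :
  (forall a b, A a -> A b -> segment a b `<=` A) ->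
  (forall a, a \in P -> A a) -> forall a, a \in iter n midpoints P -> A a.
Proof.
move=> Ac PA; elim: n => [|n IH] //= x /allpairsP[[a b] /= [/IH aA /IH bA ->]].
exact: Ac aA bA _ (segment_midpoint a b).
Qed.

(* By the medial subdivision into four triangles. *)
Lemma triangle_subdivide P a b c x (d : R) :
  a \in P -> b \in P -> c \in P -> triangle a b c x ->
  euclid_dist a b <= d -> euclid_dist b c <= d -> euclid_dist a c <= d ->
  exists a' b' c', [/\ a' \in midpoints P, b' \in midpoints P,
    c' \in midpoints P, triangle a' b' c' x &
    [/\ euclid_dist a' b' <= d / 2, euclid_dist b' c' <= d / 2 &
        euclid_dist a' c' <= d / 2]].
Proof.
move=> aP bP cP [k [l [m [k0 l0 m0 klm ->]]]] ab bc ac.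
have half y z (e : R) : euclid_dist y z <= e -> euclid_dist y z / 2 <= e / 2.
  by move=> ?; rewrite ler_pM2r// invr_gt0.
have ba : euclid_dist b a <= d by rewrite euclid_dist_sym.
have ca : euclid_dist c a <= d by rewrite euclid_dist_sym.
have cb : euclid_dist c b <= d by rewrite euclid_dist_sym.
have kE : k = 1 - l - m by lra.
(* A weight of at least 1/2 puts [x] in the half-size triangle at that corner. Writing the corner as
   [midpoint a a] lets [euclid_dist_midpoint] treat all three sides alike. *)
have [k2|k2] := leP 2^-1 k.
  exists (midpoint a a), (midpoint a b), (midpoint a c).
  split; rewrite ?mem_midpoints ?euclid_dist_midpoint//; last by split; apply: half.
  exists (2 * k - 1), (2 * l), (2 * m); split; [lra|lra|lra|lra|].
  by apply/rowP => i; rewrite !mxE kE; field.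
have [l2|l2] := leP 2^-1 l.
  exists (midpoint b a), (midpoint b b), (midpoint b c).
  split; rewrite ?mem_midpoints ?euclid_dist_midpoint//; last by split; apply: half.
  exists (2 * k), (2 * l - 1), (2 * m); split; [lra|lra|lra|lra|].
  by apply/rowP => i; rewrite !mxE kE; field.
have [m2|m2] := leP 2^-1 m.
  exists (midpoint c a), (midpoint c b), (midpoint c c).
  split; rewrite ?mem_midpoints ?euclid_dist_midpoint//; last by split; apply: half.
  exists (2 * k), (2 * l), (2 * m - 1); split; [lra|lra|lra|lra|].
  by apply/rowP => i; rewrite !mxE kE; field.
(* All weights are below 1/2, so [x] is in the middle triangle, where each midpoint gets 1 minus
   twice the weight of the opposite corner. *)
exists (midpoint a b), (midpoint b c), (midpoint c a).
split; rewrite ?mem_midpoints//.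
  exists (1 - 2 * m), (1 - 2 * k), (1 - 2 * l); split; [lra|lra|lra|lra|].
  by apply/rowP => i; rewrite !mxE kE; field.
split.
- by rewrite (midpointC a b) euclid_dist_midpoint; apply: half.
- by rewrite (midpointC b c) euclid_dist_midpoint; apply: half.
- by rewrite (midpointC c a) euclid_dist_midpoint; apply: half.
Qed.

Lemma polygon_small_triangle P n x (d : R) :
  (forall a b, a \in P -> b \in P -> euclid_dist a b <= d) -> polygon P x ->
  exists a b c, [/\ a \in iter n midpoints P, b \in iter n midpoints P,
    c \in iter n midpoints P, triangle a b c x &
    [/\ euclid_dist a b <= d / 2 ^+ n, euclid_dist b c <= d / 2 ^+ n &
        euclid_dist a c <= d / 2 ^+ n]].
Proof.
move=> Pd [a [b [c [aP bP cP abcx]]]]; elim: n => [|n].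
  by exists a, b, c; split=> //; rewrite expr0 divr1; split; exact: Pd.
move=> [a' [b' [c' [a'P b'P c'P tx [ab bc ac]]]]].
rewrite iterS exprSr invfM mulrA.
exact: triangle_subdivide a'P b'P c'P tx ab bc ac.
Qed.

(** * The complete set of segments on a point set, and the upper bound on its diameter *)

Definition wires P : set pt := [set x | exists a b,
  [/\ a \in P, b \in P & segment a b x]].

Lemma sub_wires P a b : a \in P -> b \in P -> segment a b `<=` wires P.
Proof. by move=> aP bP x abx; exists a, b. Qed.

Lemma wires_subset P Q : {subset P <= Q} -> wires P `<=` wires Q.
Proof. by move=> PQ x [a [b [aP bP abx]]]; exists a, b; split=> //; exact: PQ. Qed.

(** The segment through [x] is followed towards its end [u]. If it meets a side of the triangle at
    [y], that side is itself a wire and leads to a corner [v]; both moves stay in the triangle,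
    whose diameter is at most [d]. *)
Lemma wires_near_corner P a b c x (d : R) :
  a \in P -> b \in P -> c \in P -> triangle a b c x -> wires P x ->
  euclid_dist a b <= d -> euclid_dist b c <= d -> euclid_dist a c <= d ->
  exists y v, [/\ v \in P, segment x y `<=` wires P, segment y v `<=` wires P,
    euclid_dist x y <= d & euclid_dist y v <= d].
Proof.
move=> aP bP cP tx [u [w [uP wP uwx]]] ab bc ac.
have diam := triangle_diameter ab bc ac.
have d0 : 0 <= d by rewrite (le_trans _ ab)// euclid_distE enorm_ge0.
have uwu := segment_left u w.
have [tu|[y [xuy ty side]]] := triangle_exit u tx.
  exists u, u; split=> //.
  - exact: subset_trans (segment_convex uwx uwu) (sub_wires uP wP).
  - exact: sub_wires.
  - exact: diam.
  - by rewrite euclid_dist_xx.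
have xyP : segment x y `<=` wires P.
  apply: subset_trans (segment_convex uwx _) (sub_wires uP wP).
  exact: segment_convex uwx uwu _ xuy.
have [v [v' [vP v'P tv vv'y]]] : exists v v',
    [/\ v \in P, v' \in P, triangle a b c v & segment v v' y].
  case: side => [|[]] sy.
  - by exists a, b; split=> //; exact: triangle_cornerl.
  - exists b, c; split=> //; exists 0, 1, 0; split=> //; first by rewrite addr0 add0r.
    by rewrite !scale0r scale1r addr0 add0r.
  - by exists a, c; split=> //; exact: triangle_cornerl.
exists y, v; split=> //; [|exact: diam|exact: diam].
apply: subset_trans (segment_convex vv'y _) (sub_wires vP v'P).
exact: segment_left.
Qed.

Lemma geo_diam_wires_le P (D d : R) :
  (forall a b, a \in P -> b \in P -> euclid_dist a b <= D) ->
  (forall x, wires P x -> exists a b c,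
    [/\ a \in P, b \in P, c \in P, triangle a b c x &
     [/\ euclid_dist a b <= d, euclid_dist b c <= d & euclid_dist a c <= d]]) ->
  (geo_diam (wires P) <= (D + 4 * d)%:E)%E.
Proof.
move=> PD Pd; apply: ge_ereal_sup => _ [x Px [x' Px' <-]].
have near z : wires P z -> exists y v, [/\ v \in P, segment z y `<=` wires P,
    segment y v `<=` wires P, euclid_dist z y <= d & euclid_dist y v <= d].
  move=> Pz; have [a [b [c [aP bP cP tz [ab bc ac]]]]] := Pd _ Pz.
  exact: wires_near_corner tz Pz ab bc ac.
have [y [v [vP xy yv dxy dyv]]] := near _ Px.
have [y' [v' [v'P xy' yv' dxy' dyv']]] := near _ Px'.
(* The chain has four sides of length at most [d] and a middle one, from [v] to [v'], of length at
   most [D]. *)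
apply: ge_ereal_inf; exists (path_length x [:: y; v; v'; y'; x'])%:E.
  exists [:: y; v; v'; y'; x'] => //=; split=> //; do ?split=> //.
  - exact: sub_wires.
  - by rewrite segment_sym.
  - by rewrite segment_sym.
rewrite lee_fin /path_length /= !big_cons big_nil addr0.
have := PD _ _ vP v'P.
by rewrite (euclid_dist_sym v') (euclid_dist_sym y' x'); lra.
Qed.

(** * Lower bound by the Euclidean diameter of the convex hull *)

Lemma euclid_dist_path_length p s :
  euclid_dist p (last p s) <= path_length p s.
Proof.
rewrite /path_length; elim: s p => [|x s IH] p /=.
  by rewrite big_nil euclid_dist_xx.
rewrite big_cons (le_trans (euclid_dist_triangle x _ _))// lerD2l.
exact: IH.
Qed.

Lemma euclid_dist_geo_diam X p q : X p -> X q ->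
  ((euclid_dist p q)%:E <= geo_diam X)%E.
Proof.
move=> Xp Xq; apply: le_ereal_sup_tmp; exists (geo_dist X p q).
  by exists p => //; exists q.
by apply: le_ereal_inf_tmp => _ [s [_ <-] <-]; rewrite lee_fin euclid_dist_path_length.
Qed.

Lemma convex_setE (A : set pt) : @convex_set R pt A <->
  forall a b, A a -> A b -> segment a b `<=` A.
Proof.
split=> [cA a b Aa Ab x [t /andP[t0 t1] ->]|cA a b t].
  (* [convex_set] puts the parameter on the first point and [segment] on the second, hence the
     switch to [1 - t]. *)
  have t01 : 0 <= 1 - t <= 1 by lra.
  have := cA a b (Itv01 (proj1 (andP t01)) (proj2 (andP t01))).
  rewrite !inE => /(_ Aa Ab) At; rewrite -[t in t *: b](subKr 1); exact: At.
rewrite !inE => Aa Ab; apply: (cA b a) => //; exists (t%:num).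
  by rewrite ge0 le1.
by rewrite addrC.
Qed.

Lemma convex_hull_convex X a b : convex_hull X a -> convex_hull X b ->
  segment a b `<=` convex_hull X.
Proof.
move=> Xa Xb x abx A [cA XA]; move/convex_setE: (cA); apply; last exact: abx.
- exact: Xa.
- exact: Xb.
Qed.

Lemma convex_hull_sub X (A : set pt) :
  (forall a b, A a -> A b -> segment a b `<=` A) -> X `<=` A ->
  convex_hull X `<=` A.
Proof. by move=> /convex_setE; exact: smallest_sub. Qed.

(** For finite [g], the points within [g] of every point of a given set form an intersection of
    balls, which is convex. This extends the bound from [X] to its hull in one argument, then in the
    other. *)
Lemma euclid_diam_convex_hull_le X (g : \bar R) :
  (forall p q, X p -> X q -> ((euclid_dist p q)%:E <= g)%E) ->
  (euclid_diam (convex_hull X) <= g)%E.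
Proof.
case: g => [g| |] Xg; first last.
(* The value is minus infinity, which forces [X] to be empty. *)
- suff -> : convex_hull X = set0.
    by rewrite /euclid_diam; apply: ge_ereal_sup => _ [p []].
  rewrite -subset0; apply: convex_hull_sub => // p Xp.
  by have := Xg _ _ Xp Xp.
- exact: leey.
have ball_convex (Z : set pt) (Zg := [set y | forall z, Z z -> euclid_dist y z <= g]) :
    forall a b, Zg a -> Zg b -> segment a b `<=` Zg.
  by move=> a b Za Zb x abx z Zz; apply: euclid_dist_segment_le abx _ _; auto.
have hull1 : convex_hull X `<=` [set y | forall z, X z -> euclid_dist y z <= g].
  by apply: convex_hull_sub (@ball_convex X) _ => p Xp q Xq; rewrite -lee_fin Xg.
have hull2 : convex_hull X `<=` [set y | forall z, convex_hull X z -> euclid_dist y z <= g].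
  apply: convex_hull_sub (@ball_convex _) _ => p Xp q /hull1 Xq.
  by rewrite euclid_dist_sym; exact: Xq.
by apply: ge_ereal_sup => _ [p Xp [q Xq <-]]; rewrite lee_fin; exact: hull2.
Qed.

(** * Attaching segments successively *)

Lemma attached_endpoints X (S : seq (pt * pt)) :
  (forall s, s \in S -> [/\ s.1 != s.2, X s.1 & X s.2]) -> attached X S.
Proof.
elim: S X => [|s S IH] X //= XS.
have [? ? ?] := XS s (mem_head _ _); split=> //; apply: IH => r rS.
have [|? ? ?] := XS r; first by rewrite inE rS orbT.
by split=> //; left.
Qed.

Lemma add_segments_cons X (s : pt * pt) (S : seq (pt * pt)) :
  add_segments X (s :: S) = add_segments (X `|` segment s.1 s.2) S.
Proof.
rewrite /add_segments -setUA -(bigcup_setU1 (fun s => segment s.1 s.2)); congr (X `|` bigcup _ _).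
apply/seteqP; split=> r /=; rewrite inE.
  by case/predU1P; [left|right].
by case=> [->|rS]; rewrite ?eqxx ?rS ?orbT.
Qed.

Lemma add_segments_cat X (S S' : seq (pt * pt)) :
  add_segments X (S ++ S') = add_segments (add_segments X S) S'.
Proof.
elim: S X => [|s S IH] X; last by rewrite cat_cons !add_segments_cons IH.
by rewrite [X in add_segments X S']/add_segments classical_sets.set_nil bigcup_set0 setU0.
Qed.

Lemma attached_cat X (S S' : seq (pt * pt)) :
  attached X S -> attached (add_segments X S) S' -> attached X (S ++ S').
Proof.
elim: S X => [|s S IH] X /=.
  by rewrite /add_segments classical_sets.set_nil bigcup_set0 setU0.
by move=> [? ? ? XS]; rewrite add_segments_cons => XS'; split=> //; exact: IH.
Qed.

Lemma attach_wires X P : X `<=` wires P -> (forall a, a \in P -> X a) ->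
  exists S, attached X S /\ add_segments X S = wires P.
Proof.
(* [attached] demands distinct endpoints; the discarded pairs only contribute points of [P], which
   are in [X]. *)
move=> XP PX; exists [seq s <- [seq (a, b) | a <- P, b <- P] | s.1 != s.2].
split.
  apply: attached_endpoints => s; rewrite mem_filter => /andP[s12].
  by move=> /allpairsP[[a b] /= [aP bP sE]]; split=> //; rewrite sE; exact: PX.
apply/seteqP; split=> x.
  move=> [/XP//|[s /=]]; rewrite mem_filter => /andP[_].
  by move=> /allpairsP[[a b] /= [aP bP ->]] /= abx; exists a, b.
move=> [a [b [aP bP abx]]]; have [ab|ab] := eqVneq a b.
  by left; move: abx; rewrite -ab segment_xx => ->; exact: PX.
right; exists (a, b) => //=; rewrite mem_filter ab.
by apply/allpairsP; exists (a, b).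
Qed.

(** Each round is attached to the wires of the previous one: these contain all the new midpoints
    and, as old points are kept, are contained in the new wires. *)
Lemma attach_iter_midpoints X P n : X `<=` wires P -> (forall a, a \in P -> X a) ->
  exists S, attached X S /\ add_segments X S = wires (iter n midpoints P).
Proof.
move=> XP PX; elim: n => [|n [S [XS SE]]]; first exact: attach_wires.
have [||S' [XS' S'E]] := @attach_wires (wires (iter n midpoints P))
    (iter n.+1 midpoints P).
- by apply: wires_subset; exact: midpoints_sub.
- move=> x /allpairsP[[a b] /= [aP bP ->]].
  exact: sub_wires aP bP _ (segment_midpoint a b).
exists (S ++ S'); split; last by rewrite add_segments_cat SE.
by apply: attached_cat => //; rewrite SE.
Qed.

End EuclideanPlane.

Local Open Scope ereal_scope.

Theorem theorem3 (R : realType) (N : plane_network R) :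
  network_connected N ->
  euclid_diam (convex_hull (locus N)) < geo_diam (locus N) ->
  forall eps : R, (0 < eps)%R ->
  euclid_diam (convex_hull (locus N)) + eps%:E < geo_diam (locus N) ->
  exists S : seq ('rV[R]_2 * 'rV[R]_2),
    [/\ shortcut_set (locus N) S,
        euclid_diam (convex_hull (locus N))
          <= geo_diam (add_segments (locus N) S)
      & geo_diam (add_segments (locus N) S)
          < euclid_diam (convex_hull (locus N)) + eps%:E].
Proof.
move=> _ diam_lt eps eps0 diam_eps_lt.
set X := locus N in diam_lt diam_eps_lt *; set CX := convex_hull X in diam_lt diam_eps_lt *.
pose V : seq 'rV[R]_2 := enum_fset (vertices N).
have XCX : X `<=` CX by exact: sub_gen_smallest.
have VX a : a \in V -> X a by left.
have XV : X `<=` wires V.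
  move=> x [xV|[u [v [_ uvx]]]]; first by exists x, x; split=> //; exact: segment_left.
  by exists (val u), (val v); split=> //; exact: valP.
(* The hull diameter is finite: plus infinity contradicts the strict inequality, and minus infinity
   means an empty locus, whose geodesic diameter is minus infinity too. *)
have [D DE] : exists D : R, euclid_diam CX = D%:E.
  case E : (euclid_diam CX) diam_lt diam_eps_lt => [D| |].
  - by exists D.
  - by rewrite ltNge leey.
  move=> gdX _; exfalso; suff X0 : X = set0.
    by move: gdX; rewrite X0 /geo_diam ltNge ge_ereal_sup// => _ [x []].
  rewrite -subset0 => x Xx.
  have : (euclid_dist x x)%:E <= euclid_diam CX.
    by apply: ereal_sup_ubound; exists x; [|exists x]; rewrite //; exact: XCX.
  by rewrite E leNgt ltNyr.
have CXD a b : CX a -> CX b -> (euclid_dist a b <= D)%R.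
  move=> aC bC; rewrite -lee_fin -DE; apply: ereal_sup_ubound.
  by exists a => //; exists b.
(* By [upper_nthrootP], [2 ^+ n] exceeds [4 * D / eps], so the excess [4 * (D / 2 ^+ n)] is below
   [eps]. *)
pose n := Num.bound (4 * D / eps)%R.
have n_large : (D + 4 * (D / 2 ^+ n) < D + eps)%R.
  rewrite ltrD2l mulrA ltr_pdivrMr ?exprn_gt0// -ltr_pdivrMl// mulrC.
  exact: upper_nthrootP.
have PC a : a \in iter n (@midpoints R) V -> CX a.
  apply: iter_midpoints_convex; first exact: convex_hull_convex.
  by move=> b /VX; exact: XCX.
have [S [XS SE]] := attach_iter_midpoints n XV VX.
have diam_le : geo_diam (add_segments X S) <= (D + 4 * (D / 2 ^+ n))%:E.
  rewrite SE; apply: geo_diam_wires_le => [a b /PC aC /PC bC|x]; first exact: CXD.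
  (* Every wire stays in [polygon V], so each of its points lies in a triangle with corners in [V],
     from which [n] halvings give a small one. *)
  have inV a : a \in iter n (@midpoints R) V -> polygon V a.
    by apply: iter_midpoints_convex; [exact: polygon_convex|exact: sub_polygon].
  move=> [a [b [/inV aV /inV bV abx]]]; apply: polygon_small_triangle.
    by move=> u v /VX /XCX uC /VX /XCX; exact: CXD.
  exact: polygon_convex abx.
exists S; split.
- split=> //; apply: le_lt_trans diam_le (lt_trans _ diam_eps_lt).
  by rewrite DE lte_fin.
- apply: euclid_diam_convex_hull_le => p q Xp Xq.
  by apply: euclid_dist_geo_diam; left.
- by rewrite DE (le_lt_trans diam_le)// lte_fin.
Qed.
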